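(* Suppose there exist positive constants $c_0$ and $r_0\le r_1$ such that: (a1) $\inf_{r\in(0,r_0]}\underline{\pi}(r)>0$; (a2) $\inf_{r\in(r_0,r_1]}\underline{\alpha}(r)>0$ and $\sup_{r\in(0,r_1]}\overline{\beta}(r)<\infty$; (a3) $\overline{\beta}(r)\le -c_0 r$ for all $r\in(r_1,\infty)$. Let $c,a>0$ be constants such that $$c\ge \sup_{r\in(r_0,r_1]}\frac{4\overline{\beta}(r)_+}{\underline{\alpha}(r)}+1,\qquad a\ge 2c(1+e^{-cr_1})\sup_{r\in(0,r_0]}\frac{\overline{\beta}(r)_+}{\underline{\pi}(r)}+1,$$ and define $$\rho(x,y)=a\mathbf 1_{\{d(x,y)>0\}}+f_0(d(x,y)),\qquad f_0(r)=1-e^{-cr}+ce^{-cr_1}r .$$ Then there exists a constant $c_*\in(0,1)$ such that for all $x,y\in S$, $$\mathbb E_{x,y}[\rho(X,Y)]\le(1-c_* )\rho(x,y).$$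
   Context: Let $(S,d)$ be a separable metric space and $p(x,dz)$ a Markov transition kernel on $S$. $((X,Y),\mathbb P_{x,y})$ is a Markov coupling of $p(x,\cdot)$ and $p(y,\cdot)$: there are random variables $X,Y:\Omega\to S$ on a common measurable space $(\Omega,\mathcal F)$ and probability measures $\mathbb P_{x,y}$ (depending on $(x,y)\in S\times S$ as a probability kernel) such that under $\mathbb P_{x,y}$, $X\sim p(x,\cdot)$ and $Y\sim p(y,\cdot)$. It is assumed that $\mathbb P_{x,x}(X=Y)=1$ for all $x\in S$. $\mathbb E_{x,y}$ is expectation under $\mathbb P_{x,y}$. For $x,y\in S$ put $\pi(x,y)=\mathbb P_{x,y}(d(X,Y)=0)$, $\beta(x,y)=\mathbb E_{x,y}[d(X,Y)-d(x,y)]$, $\alpha(x,y)=\frac12\mathbb E_{x,y}[(d(X,Y)-d(x,y))^2\mathbf 1_{\{d(X,Y)<d(x,y)\}}]$. For $r>0$ put $\underline\pi(r)=\inf_{d(x,y)=r}\pi(x,y)$, $\overline\beta(r)=\sup_{d(x,y)=r}\beta(x,y)$, $\underline\alpha(r)=\inf_{d(x,y)=r}\alpha(x,y)$, and $\overline\beta(r)_+=\max(\overline\beta(r),0)$. Conventions: values $r$ that are not attained as a distance are ignored in infima and suprema over $r$; a supremum of nonnegative quantities over an empty set is $0$, and positivity of an infimum over an empty set is vacuous (e.g. when $r_0=r_1$). *)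

(* Defs.v *)
From HB Require Import structures.
From mathcomp Require Import all_boot all_order all_algebra.
From mathcomp Require Import all_classical all_reals all_analysis.

Set Implicit Arguments.
Unset Strict Implicit.
Unset Printing Implicit Defensive.
Import Order.TTheory GRing.Theory Num.Theory.
Import numFieldNormedType.Exports.

Local Open Scope classical_set_scope.
Local Open Scope ring_scope.
Local Open Scope ereal_scope.

(* The metric and the sigma-algebra are unrelated in this structure; that the
   sigma-algebra is the Borel one is the separate condition [borel_space]. *)
#[short(type="measurableMetricType")]
HB.structure Definition MeasurableMetric (R : realType) d :=
  {T of Metric R T & Measurable d T}.

Definition separable_space (T : topologicalType) : Prop :=
  exists D : set T, countable D /\ dense D.

Definition borel_space (R : realType) (d : measure_display)
    (S : measurableMetricType R d) : Prop :=
  (measurable : set (set S)) = <<s (open : set (set S)) >>.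

Section markov_coupling.
Context (R : realType) (d d' : measure_display).
Context (S : measurableMetricType R d) (Omega : measurableType d').
Variables (P : R.-pker (S * S)%type ~> Omega) (X Y : {mfun Omega >-> S}).

Definition markov_coupling (p : R.-pker S ~> S) : Prop :=
  forall (x y : S) (A : set S), measurable A ->
    pushforward (P (x, y)) X A = p x A /\ pushforward (P (x, y)) Y A = p y A.

Definition coupling_pi (x y : S) : \bar R :=
  P (x, y) [set w | mdist (X w) (Y w) = 0%R].

(* The integrand is bounded below by [- mdist x y], so that the integral is
   well defined, possibly +oo. *)
Definition coupling_beta (x y : S) : \bar R :=
  \int[P (x, y)]_w (mdist (X w) (Y w) - mdist x y)%:E.

Definition coupling_alpha (x y : S) : \bar R :=
  (2^-1)%:E * \int[P (x, y)]_w
    ((mdist (X w) (Y w) - mdist x y) ^+ 2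
       * \1_[set w' | (mdist (X w') (Y w') < mdist x y)%R] w)%:E.

(* When r is not the distance of any two points, the infima below are +oo and
   the supremum is -oo. *)
Definition pi_inf (r : R) : \bar R :=
  ereal_inf [set coupling_pi z.1 z.2 | z in [set z : S * S | mdist z.1 z.2 = r]].

Definition beta_sup (r : R) : \bar R :=
  ereal_sup [set coupling_beta z.1 z.2 | z in [set z : S * S | mdist z.1 z.2 = r]].

Definition alpha_inf (r : R) : \bar R :=
  ereal_inf [set coupling_alpha z.1 z.2 | z in [set z : S * S | mdist z.1 z.2 = r]].

End markov_coupling.

Definition attained (R : realType) (d : measure_display)
    (S : measurableMetricType R d) (I : set R) : set R :=
  [set r | I r /\ exists x y : S, mdist x y = r].

(* Supremum in [0, +oo] of a set of nonnegative values: 0 on the empty set. *)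
Definition ereal_sup_ge0 (R : realType) (A : set (\bar R)) : \bar R :=
  maxe (ereal_sup A) 0.

Definition f0 (R : realType) (c r1 r : R) : R :=
  (1 - expR (- (c * r)) + c * expR (- (c * r1)) * r)%R.

Definition rho (R : realType) (d : measure_display)
    (S : measurableMetricType R d) (a c r1 : R) (x y : S) : R :=
  (a * (0 < mdist x y)%R%:R + f0 c r1 (mdist x y))%R.

(* Main.v *)
Require Import Defs.
From HB Require Import structures.
From mathcomp Require Import all_boot all_order all_algebra.
From mathcomp Require Import all_classical all_reals all_analysis.
From mathcomp Require Import measurable_realfun ring lra.

(** The function [f0] is increasing and concave, with
    f0' r = c e^(-c r) + c e^(-c r1)  and  f0'' r = - c^2 e^(-c r),
    and f0'' is increasing. A Taylor expansion at r = d(x,y) therefore gives,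
    with D = d(X,Y), the pointwise bound
      f0 D <= f0 r + f0' r (D - r) + 1/2 f0'' r (D - r)^2 1_{D < r},
    where the second-order gain is kept only on {D < r}, the side on which
    f0'' D <= f0'' r ([f0_le_taylor]). Taking expectations and using
    E[1_{D > 0}] = 1 - pi yields a single inequality for x <> y
    ([expectation_rho_le]):
      E rho(X,Y) <= a (1 - pi) + f0 r + f0' r beta - c^2 e^(-c r) alpha.

    Each range of r has its own source of negative drift:
    - for 0 < r <= r0, coalescence: the lower bound on [a] makes f0' r beta at
      most half of (a - 1) pi, so that the jump term - a pi wins
      ([drift_small]);
    - for r0 < r <= r1, concavity: the lower bound on [c] makes f0' r beta at
      most half of c^2 e^(-c r) alpha ([drift_medium]);
    - for r > r1, the drift itself: beta <= - c0 r, while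
      f0' r >= c e^(-c r1) ([drift_large]).
    In the first two ranges the gain is bounded below by a constant while
    rho(x,y) is bounded above; in the third the gain is linear in r and
    rho(x,y) grows at most linearly. So the gain dominates a fixed multiple of
    rho(x,y) in all three. When x = y, both sides vanish. *)

Set Implicit Arguments.
Unset Strict Implicit.
Unset Printing Implicit Defensive.
Import Order.TTheory GRing.Theory Num.Theory.
Import numFieldNormedType.Exports.

Local Open Scope classical_set_scope.
Local Open Scope ring_scope.

(** * The concave distance function *)

Lemma expR_ge_quadratic (R : realType) (t : R) :
  0 <= t -> 1 + t + t ^+ 2 / 2 <= expR t.
Proof.
move=> t0; have -> : 1 + t + t ^+ 2 / 2 = series (exp_coeff t) 3.
  rewrite /series /= !big_nat_recr//= big_geq// /exp_coeff /=.
  by rewrite !factS fact0 !mul1n add0r expr0 expr1 !divr1.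
apply: nondecreasing_cvgn_le; last exact: is_cvg_series_exp_coeff.
by apply: nondecreasing_series => n _ _; exact: exp_coeff_ge0.
Qed.

(** For negative t the quadratic term has the wrong sign; the indicator of
    0 < t becomes that of D < r in the Taylor bound on [f0]. *)
Lemma expR_ge_quadratic_pos (R : realType) (t : R) :
  1 + t + (0 < t)%R%:R * t ^+ 2 / 2 <= expR t.
Proof.
case: ltP => [/ltW t0|_]; first by rewrite mul1r; exact: expR_ge_quadratic.
by rewrite !mul0r addr0; exact: expR_ge1Dx.
Qed.

(** The derivative of [f0 c r1] at [r]. *)
Definition f0_slope (R : realType) (c r1 r : R) : R :=
  c * expR (- (c * r)) + c * expR (- (c * r1)).

(** The affine part of [f0] contributes exactly; the exponential part is the
    inequality e^t >= 1 + t + 1_{0 < t} t^2 / 2 at t = c (r - u), multiplied by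
    e^(-c r). *)
Lemma f0_le_taylor (R : realType) (c r1 r u : R) : 0 < c ->
  f0 c r1 u <= f0 c r1 r + f0_slope c r1 r * (u - r)
    - c ^+ 2 * expR (- (c * r)) * (2^-1 * ((u - r) ^+ 2 * (u < r)%R%:R)).
Proof.
move=> c0; rewrite /f0 /f0_slope.
have -> : expR (- (c * u)) = expR (- (c * r)) * expR (c * (r - u)).
  by rewrite -expRD; congr expR; ring.
have := expR_ge_quadratic_pos (c * (r - u)).
rewrite pmulr_rgt0// subr_gt0 -(ler_pM2l (expR_gt0 (- (c * r)))).
set E := expR (- (c * r)); set F := expR (c * (r - u)).
by set G := expR _; set i : R := (u < r)%R%:R => h; nra.
Qed.

Lemma f0_ge0 (R : realType) (c r1 r : R) : 0 <= c -> 0 <= r -> 0 <= f0 c r1 r.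
Proof.
move=> c0 r0; rewrite /f0 addr_ge0 ?mulr_ge0 ?expR_ge0// subr_ge0.
by rewrite -expR0 ler_expR oppr_le0 mulr_ge0.
Qed.

Lemma f0_slope_ge0 (R : realType) (c r1 r : R) : 0 <= c -> 0 <= f0_slope c r1 r.
Proof. by move=> c0; rewrite addr_ge0 ?mulr_ge0 ?expR_ge0. Qed.

Lemma f0_le_affine (R : realType) (c r1 r : R) :
  f0 c r1 r <= 1 + c * expR (- (c * r1)) * r.
Proof. by rewrite /f0 lerD2r gerBl expR_ge0. Qed.

(** * Measurability of the distance between two random points *)

Section measurable_distance.
Context (R : realType) (d d' : measure_display).
Context (S : measurableMetricType R d) (Omega : measurableType d').
Hypothesis S_borel : borel_space S.

Lemma open_mdist_lt (q : S) (t : R) : open [set y | mdist q y < t].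
Proof.
rewrite openE => y /= qy; apply/nbhs_ballP; exists (t - mdist q y) => /=.
  by rewrite subr_gt0.
move=> z; rewrite ballEmdist /= => yz.
by rewrite (le_lt_trans (metric_triangle q y z))// addrC -ltrBrDr.
Qed.

Lemma measurable_mdist_point (X : {mfun Omega >-> S}) (q : S) :
  measurable_fun setT (fun w => mdist q (X w)).
Proof.
apply: (measurability _ (measurable_realfun.RGenInftyO.measurableE R)) => //.
move=> _ [_ [t ->] <-]; rewrite setTI.
have -> : (fun w => mdist q (X w)) @^-1` `]-oo, t[ =
          X @^-1` [set y | mdist q y < t].
  by apply/seteqP; split => w /=; rewrite in_itv.
apply: measurable_funPTI; rewrite S_borel.
by apply: sub_sigma_algebra; exact: open_mdist_lt.
Qed.

(** In general d is only measurable for the Borel sets of the product, which may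
    be more than the product sigma-algebra. Separability removes the gap: for a
    countable dense D, d(X,Y) is the infimum over q in D of d(q,X) + d(q,Y). *)
Lemma measurable_mdist (X Y : {mfun Omega >-> S}) : separable_space S ->
  measurable_fun setT (fun w => mdist (X w) (Y w)).
Proof.
move=> [D [cD dD]].
apply: (measurability _ (measurable_realfun.RGenInftyO.measurableE R)) => //.
move=> _ [_ [t ->] <-]; rewrite setTI.
have -> : (fun w => mdist (X w) (Y w)) @^-1` `]-oo, t[ =
  \bigcup_(q in D) ((fun w => mdist q (X w) + mdist q (Y w)) @^-1` `]-oo, t[).
  apply/seteqP; split => [w /=|w [q _] /=]; rewrite !in_itv /=; last first.
    by apply: le_lt_trans; rewrite (metric_sym q (X w)); exact: metric_triangle.
  (* A dense point this close to [X w] loses at most 2e in the triangle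
     inequality. *)
  move=> XYt; pose e := (t - mdist (X w) (Y w)) / 2.
  have e0 : 0 < e by rewrite divr_gt0// subr_gt0.
  have [|q [/= Xq Dq]] := dD [set y | mdist (X w) y < e] _ (@open_mdist_lt _ _).
    by exists (X w); rewrite /= mdistxx.
  exists q => //=; rewrite in_itv /=.
  have := metric_triangle q (X w) (Y w); rewrite (metric_sym q (X w)).
  rewrite /e in Xq; lra.
rewrite bigcup_set_type; apply: countable_bigcupT_measurable => [|q].
  by rewrite (eq_countable (card_setT D)).
rewrite -[_ @^-1` _]setTI.
by apply: measurable_funD => //; exact: measurable_mdist_point.
Qed.

End measurable_distance.

(** * Drift in the three ranges of the distance *)

Section drift_regimes.
Context (R : realType) (a c r1 r : R).
Hypotheses (a_gt0 : 0 < a) (c_gt0 : 0 < c).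

Let e1 : R := expR (- (c * r1)).

Lemma f0_slope_le : 0 <= r -> f0_slope c r1 r <= c * (1 + e1).
Proof.
move=> r0; rewrite /f0_slope -mulrDr ler_pM2l// lerD2r -expR0 ler_expR.
by rewrite oppr_le0 mulr_ge0// ltW.
Qed.

(** The linear part of [f0] has the slope that the exponential part reaches at
    r1, so below r1 it contributes at most half of the total. *)
Lemma f0_slope_le_near : r <= r1 ->
  f0_slope c r1 r <= 2 * c * expR (- (c * r)).
Proof.
move=> rr1; have : expR (- (c * r1)) <= expR (- (c * r)).
  by rewrite ler_expR lerN2 ler_pM2l.
by rewrite /f0_slope; have := c_gt0; nra.
Qed.

(** T stands for the supremum of beta_+ / pi. The condition on [a] gives
    f0' r beta <= (a - 1) / 2 p, so that half of the gain a p remains. *)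
Lemma drift_small (T p m b al : R) : 0 <= r -> 0 <= T ->
  2 * c * (1 + e1) * T + 1 <= a -> 0 < m -> m <= p -> b <= T * p -> 0 <= al ->
  a * (1 - p) + f0 c r1 r + f0_slope c r1 r * b - c ^+ 2 * expR (- (c * r)) * al
  <= a + f0 c r1 r - a * m / 2.
Proof.
move=> r0 T0 aT m0 mp bT al0.
have sb : f0_slope c r1 r * b <= c * (1 + e1) * (T * p).
  apply: (@le_trans _ _ (f0_slope c r1 r * (T * p))).
    by rewrite ler_wpM2l// f0_slope_ge0// ltW.
  by rewrite ler_wpM2r ?f0_slope_le// mulr_ge0// (le_trans (ltW m0)).
have k0 : 0 <= c ^+ 2 * expR (- (c * r)) * al.
  by rewrite mulr_ge0// mulr_ge0 ?sqr_ge0 ?expR_ge0.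
have : c * (1 + e1) * (T * p) <= (a - 1) / 2 * p by nra.
have : a * m <= a * p by rewrite ler_pM2l.
nra.
Qed.

(** T stands for the supremum of 4 beta_+ / alpha. Since f0' r <= 2 c e^(-c r),
    the positive drift is at most c (c - 1) / 2 e^(-c r) al, that is less than
    half of the second-order gain. *)
Lemma drift_medium (T p m b al : R) : r <= r1 -> 0 <= T -> T + 1 <= c ->
  0 <= p -> 0 < m -> m <= al -> 4 * b <= T * al ->
  a * (1 - p) + f0 c r1 r + f0_slope c r1 r * b - c ^+ 2 * expR (- (c * r)) * al
  <= a + f0 c r1 r - c ^+ 2 / 2 * e1 * m.
Proof.
move=> rr1 T0 Tc p0 m0 mal bT.
have ee : e1 <= expR (- (c * r)) by rewrite ler_expR lerN2 ler_pM2l.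
have al0 : 0 <= al by rewrite (le_trans (ltW m0)).
set e := expR (- (c * r)) in ee *; have e0 : 0 < e by exact: expR_gt0.
have ap : 0 <= a * p by rewrite mulr_ge0// ltW.
have sb : f0_slope c r1 r * b <= 2 * c * e * (c / 4 * al).
  apply: (@le_trans _ _ (f0_slope c r1 r * (c / 4 * al))).
    by rewrite ler_wpM2l ?f0_slope_ge0 ?ltW//; nra.
  rewrite ler_wpM2r// ?f0_slope_le_near//.
  by rewrite mulr_ge0// divr_ge0// ltW.
have : c ^+ 2 / 2 * (e1 * m) <= c ^+ 2 / 2 * (e * al).
  by rewrite ler_wpM2l ?divr_ge0 ?sqr_ge0// ler_pM ?expR_ge0// ltW.
nra.
Qed.

Lemma drift_large (c0 p b al : R) : 0 < c0 -> 0 <= r -> 0 <= p -> 0 <= al ->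
  b <= - c0 * r ->
  a * (1 - p) + f0 c r1 r + f0_slope c r1 r * b - c ^+ 2 * expR (- (c * r)) * al
  <= a + f0 c r1 r - c * e1 * c0 * r.
Proof.
move=> c00 r0 p0 al0 bc.
have sb : f0_slope c r1 r * b <= f0_slope c r1 r * (- c0 * r).
  by rewrite ler_wpM2l// f0_slope_ge0// ltW.
have sl : c * e1 * (c0 * r) <= f0_slope c r1 r * (c0 * r).
  rewrite ler_wpM2r ?mulr_ge0 ?(ltW c00)// /f0_slope lerDr.
  by rewrite mulr_ge0 ?expR_ge0// ltW.
have k0 : 0 <= c ^+ 2 * expR (- (c * r)) * al.
  by rewrite mulr_ge0// mulr_ge0 ?sqr_ge0 ?expR_ge0.
have ap : 0 <= a * p by rewrite mulr_ge0// ltW.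
nra.
Qed.

End drift_regimes.

Local Open Scope ereal_scope.

(** * Extended real infima, suprema and ratios *)

(** A real witness is used in place of the infimum itself, which is +oo when no
    distance is attained in the range. *)
Lemma ereal_gt0_lbound (R : realType) (e : \bar R) :
  0 < e -> exists2 m : R, (0 < m)%R & m%:E <= e.
Proof.
case: e => [m| |] //; first by rewrite lte_fin; exists m.
by move=> _; exists 1%R => //; exact: leey.
Qed.

(** Passes from a ratio formed with the infimum A to an individual value v of the
    denominator: enlarging A to v only weakens the bound, because t >= 0. *)
Lemma le_of_ratio_le (R : realType) (n A : \bar R) (x v t : R) :
  0 <= n -> x%:E <= n -> 0 < A -> A <= v%:E -> n / A <= t%:E ->
  (0 <= t)%R -> (x <= t * v)%R.
Proof.
move=> n0 xn; case: A => [al| |] //; rewrite lte_fin lee_fin => al0 alv.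
rewrite inver gt_eqF// lee_pdivrMr// => /(le_trans xn).
by rewrite -EFinM lee_fin => /le_trans xt t0; apply: xt; rewrite ler_wpM2l.
Qed.

(** Turns a constraint on [c] or [a] into real arithmetic: it forces the supremum
    to be a nonnegative real. *)
Lemma ereal_sup_ge0_affine (R : realType) (A : set (\bar R)) (k v : R) :
  (0 < k)%R -> k%:E * ereal_sup_ge0 A + 1 <= v%:E ->
  exists t : R, [/\ (0 <= t)%R, (k * t + 1 <= v)%R & ubound A t%:E].
Proof.
move=> k0; have s0 : 0 <= ereal_sup_ge0 A by rewrite le_max lexx orbT.
have sA : ubound A (ereal_sup_ge0 A).
  by move=> z Az; rewrite le_max ereal_sup_ubound.
case: (ereal_sup_ge0 A) s0 sA => [t| |] //.
  rewrite lee_fin => t0 tA; rewrite -EFinM -EFinD lee_fin => kt.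
  by exists t.
by move=> _ _; rewrite gt0_muley ?lte_fin.
Qed.

(** * The one-step bound on the expectation *)

Section expectation_bound.
Context (R : realType) (d : measure_display) (T : measurableType d).
Variables (Q : probability T R) (D : T -> R).
Hypothesis D_meas : measurable_fun setT D.
Hypothesis D_ge0 : forall w, (0 <= D w)%R.

(** The negative part of D - r is at most r, so an integral that is not +oo
    forces the positive part to be integrable too. *)
Lemma integrable_of_integral_lty (r : R) : (0 <= r)%R ->
  \int[Q]_w (D w - r)%:E < +oo ->
  Q.-integrable setT (EFin \o (fun w => D w - r)%R).
Proof.
move=> r0 intD.
have mf : measurable_fun setT (fun w => (D w - r)%:E).
  by apply/measurable_EFinP; exact: measurable_funB.
have mfp := measurable_funepos mf; have mfn := measurable_funeneg mf.
have intn : \int[Q]_w (fun w => (D w - r)%:E)^\- w <= r%:E.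
  have -> : r%:E = \int[Q]_w cst r%:E w.
    rewrite integral_cst//.
    by rewrite -[LHS]mule1; congr (_ * _); exact/esym/probability_setT.
  apply: ge0_le_integral => // w _; rewrite funenegE /=.
  by rewrite -EFin_max lee_fin ge_max r0 andbT opprB gerBl.
have intn0 : 0 <= \int[Q]_w (fun w => (D w - r)%:E)^\- w by exact: integral_ge0.
have finn : \int[Q]_w (fun w => (D w - r)%:E)^\- w \is a fin_num.
  by rewrite ge0_fin_numE// (le_lt_trans intn)// ltry.
apply/integrableP; split => //.
rewrite (eq_integral (fun w => (fun w => (D w - r)%:E)^\+ w
                               + (fun w => (D w - r)%:E)^\- w)); last first.
  by move=> w _; rewrite -[LHS]/((abse \o (fun w => (D w - r)%:E)) w) fune_abse.
rewrite ge0_integralD//; apply: lte_add_pinfty; last first.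
  by rewrite (le_lt_trans intn)// ltry.
move: intD; rewrite [X in X < +oo -> _]integralE lteBlDr//.
by move=> /lt_le_trans; apply; exact: leey.
Qed.

Definition left_square (r : R) (w : T) : R :=
  ((D w - r) ^+ 2 * \1_[set w' | (D w' < r)%R] w)%R.

Lemma left_squareE (r : R) w :
  left_square r w = ((D w - r) ^+ 2 * (D w < r)%R%:R)%R.
Proof. by rewrite /left_square indicE; congr (_ * _%:R)%R; rewrite mem_setE. Qed.

Lemma measurable_left_square (r : R) : measurable_fun setT (left_square r).
Proof.
apply: measurable_funM.
  by apply: measurable_funX; exact: measurable_funB.
apply: measurable_indic.
rewrite -[X in measurable X]setTI.
exact: (@measurable_fun_ltr _ _ _ _ D (cst r)).
Qed.

Lemma left_square_bounded (r : R) w : (0 <= left_square r w <= r ^+ 2)%R.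
Proof.
rewrite left_squareE; case: ltP => [Dr|_] /=.
  by rewrite mulr1 sqr_ge0 /=; have := D_ge0 w; nra.
by rewrite mulr0 lexx sqr_ge0.
Qed.

Lemma integrable_left_square (r : R) :
  Q.-integrable setT (EFin \o left_square r).
Proof.
have iC := finite_measure_integrable_cst Q (r ^+ 2) measurableT.
apply: (le_integrable _ _ _ iC) => //.
  by apply/measurable_EFinP; exact: measurable_left_square.
move=> w _ /=; have /andP[h0 h1] := left_square_bounded r w.
by rewrite lee_fin !ger0_norm// (le_trans h0).
Qed.

Lemma measurable_f0 (c r1 : R) : measurable_fun setT (f0 c r1).
Proof.
apply: measurable_funD; last exact: measurable_funM.
apply: measurable_funB => //.
apply: measurableT_comp; first exact: measurable_expR.
by apply: measurableT_comp => //; exact: measurable_funM.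
Qed.

Lemma measurable_rho_dist (a c r1 : R) :
  measurable_fun setT (fun w => a * (0 < D w)%R%:R + f0 c r1 (D w))%R.
Proof.
apply: measurable_funD; last first.
  by apply: measurableT_comp => //; exact: measurable_f0.
apply: measurable_funM => //.
have -> : (fun w => (0 < D w)%R%:R) = \1_[set w | (0 < D w)%R] :> (T -> R).
  by apply/funext => w; rewrite indicE mem_setE.
apply: measurable_indic; rewrite -[X in measurable X]setTI.
exact: (@measurable_fun_ltr _ _ _ _ (cst 0%R) D).
Qed.

Lemma integral_rho_dist0 (a c r1 : R) : Q [set w | D w = 0%R] = 1 ->
  \int[Q]_w (a * (0 < D w)%R%:R + f0 c r1 (D w))%:E = 0.
Proof.
move=> QD0; have mZ : measurable [set w | D w = 0%R].
  rewrite -[X in measurable X]setTI.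
  exact: (D_meas measurableT (measurable_set1 0%R)).
transitivity (\int[Q]_w (cst 0 w : \bar R)); last exact: integral0.
apply: ae_eq_integral => //.
  by apply/measurable_EFinP; exact: measurable_rho_dist.
exists (~` [set w | D w = 0%R]); split.
- exact: measurableC.
- by rewrite [LHS]probability_setC// QD0 subee.
- apply: subsetC => w /= Dw _.
  by rewrite Dw ltxx mulr0 add0r /f0 mulr0 oppr0 expR0 subrr mulr0 addr0.
Qed.

(** For D = d(X,Y) and r = d(x,y), the numbers p, b and al are pi, beta and alpha
    at (x,y); that they are real lets the remaining argument take place in R. *)
Lemma expectation_rho_le (a c r1 r : R) :
  (0 <= a)%R -> (0 < c)%R -> (0 <= r)%R ->
  \int[Q]_w (D w - r)%:E < +oo ->
  exists p b al : R,
    [/\ Q [set w | D w = 0%R] = p%:E,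
        \int[Q]_w (D w - r)%:E = b%:E,
        (2^-1)%:E * \int[Q]_w (left_square r w)%:E = al%:E
      & \int[Q]_w (a * (0 < D w)%R%:R + f0 c r1 (D w))%:E
        <= (a * (1 - p) + f0 c r1 r + f0_slope c r1 r * b
            - c ^+ 2 * expR (- (c * r)) * al)%:E].
Proof.
move=> a0 c0 r0 Dfin.
have mZ : measurable [set w | D w = 0%R].
  rewrite -[X in measurable X]setTI.
  exact: (D_meas measurableT (measurable_set1 0%R)).
have iB := integrable_of_integral_lty r0 Dfin.
have iL := integrable_left_square r.
have iZ := integrable_indic Q mZ.
have pE : Q [set w | D w = 0%R] = (\int[Q]_w \1_[set w | D w = 0%R] w)%:E.
  rewrite fineK ?integrable_fin_num// integral_indic// setIT//.
have bE : \int[Q]_w (D w - r)%:E = (\int[Q]_w (D w - r))%:E.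
  by rewrite fineK// integrable_fin_num.
have lE : \int[Q]_w (left_square r w)%:E = (\int[Q]_w left_square r w)%:E.
  by rewrite fineK// integrable_fin_num.
exists (\int[Q]_w \1_[set w | D w = 0%R] w)%R, (\int[Q]_w (D w - r))%R,
  (2^-1 * \int[Q]_w left_square r w)%R; split => //.
  by rewrite lE EFinM.
have iC := finite_measure_integrable_cst Q (a + f0 c r1 r) measurableT.
set s := f0_slope c r1 r; set k := (c ^+ 2 * expR (- (c * r)))%R.
have isB : Q.-integrable setT (EFin \o (fun w => s * (D w - r))%R).
  exact: (integrableZl measurableT s iB).
have ikL : Q.-integrable setT (EFin \o (fun w => k / 2 * left_square r w)%R).
  exact: (integrableZl measurableT (k / 2)%R iL).
have iaZ : Q.-integrable setT
    (EFin \o (fun w => a * \1_[set w | D w = 0%R] w)%R).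
  exact: (integrableZl measurableT a iZ).
have iu : Q.-integrable setT
    (EFin \o (fun w => (a + f0 c r1 r) + s * (D w - r))%R).
  exact: (integrableD measurableT iC isB).
have il : Q.-integrable setT
    (EFin \o (fun w => k / 2 * left_square r w
                       + a * \1_[set w | D w = 0%R] w)%R).
  exact: (integrableD measurableT ikL iaZ).
(* The indicator of D > 0 is replaced by 1 minus that of D = 0, whose
   integral is p. *)
set h := (fun w => ((a + f0 c r1 r) + s * (D w - r))
  - (k / 2 * left_square r w + a * \1_[set w | D w = 0%R] w))%R.
have ih : Q.-integrable setT (EFin \o h).
  exact: (integrableB measurableT iu il).
apply: (@le_trans _ _ (\int[Q]_w (h w)%:E)).
  apply: ge0_le_integral => //.
  - by move=> w _; rewrite lee_fin addr_ge0 ?mulr_ge0 ?f0_ge0 ?ler0n ?(ltW c0).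
  - by apply/measurable_EFinP; exact: measurable_rho_dist.
  - exact: measurable_int ih.
  - move=> w _; rewrite lee_fin /h left_squareE.
    have := f0_le_taylor r1 r (D w) c0; rewrite -/s -/k indicE.
    rewrite lt0r D_ge0 andbT; case: (D w =P 0%R) => Dw /=.
      rewrite mem_set// mulr0 mulr1; lra.
    rewrite memNset// mulr0 mulr1; lra.
rewrite -[leLHS]fineK ?integrable_fin_num// lee_fin.
rewrite -/(Rintegral Q setT h) /h RintegralB//.
rewrite (RintegralD measurableT iC isB) (RintegralD measurableT ikL iaZ).
rewrite !RintegralZl// Rintegral_cst//.
have -> : fine (Q setT) = 1%R.
  by rewrite -[RHS]/(fine 1); congr fine; exact: probability_setT.
lra.
Qed.

End expectation_bound.

(** * The contraction *)

Section pker_fiber.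
Context d d' (T : measurableType d) (U : measurableType d') (R : realType).
Variables (k : R.-pker T ~> U) (x : T).

(** A copy of [k x] that carries the probability structure, and with it the
    finiteness needed to integrate bounded functions; [k x] itself is typed as a
    mere measure. *)
Definition pker_fiber : set U -> \bar R := k x.
HB.instance Definition _ := Measure.copy pker_fiber (k x).
HB.instance Definition _ :=
  Measure_isProbability.Build _ _ _ pker_fiber (@prob_kernel _ _ _ _ _ k x).
End pker_fiber.

Theorem theorem2p1 (R : realType) (d d' : measure_display)
    (S : measurableMetricType R d) (Omega : measurableType d')
    (S_separable : separable_space S) (S_borel : borel_space S)
    (p : R.-pker S ~> S)
    (P : R.-pker (S * S)%type ~> Omega) (X Y : {mfun Omega >-> S})
    (PXY : markov_coupling P X Y p)
    (P_diag : forall x : S, P (x, x) [set w | X w = Y w] = 1)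
    (c0 r0 r1 : R) (c0_gt0 : (0 < c0)%R) (r0_gt0 : (0 < r0)%R)
    (r0_le_r1 : (r0 <= r1)%R)
    (a1 : 0 < ereal_inf [set pi_inf P X Y r | r in attained S `]0%R, r0]])
    (a2_alpha :
      0 < ereal_inf [set alpha_inf P X Y r | r in attained S `]r0, r1]])
    (a2_beta :
      ereal_sup [set beta_sup P X Y r | r in attained S `]0%R, r1]] < +oo)
    (a3 : forall r : R, (r1 < r)%R -> beta_sup P X Y r <= (- c0 * r)%:E)
    (c a : R) (c_gt0 : (0 < c)%R) (a_gt0 : (0 < a)%R)
    (c_ge : ereal_sup_ge0
              [set 4%:E * maxe (beta_sup P X Y r) 0 / alpha_inf P X Y r
                | r in attained S `]r0, r1]] + 1 <= c%:E)
    (a_ge : (2 * c * (1 + expR (- (c * r1))))%:E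
              * ereal_sup_ge0 [set maxe (beta_sup P X Y r) 0 / pi_inf P X Y r
                                | r in attained S `]0%R, r0]] + 1 <= a%:E) :
  exists2 cs : R, (0 < cs < 1)%R &
    forall x y : S,
      \int[P (x, y)]_w (rho a c r1 (X w) (Y w))%:E
        <= ((1 - cs) * rho a c r1 x y)%:E.
Proof.
have r1_gt0 := lt_le_trans r0_gt0 r0_le_r1.
have [m1 m1_gt0 pi_ge] := ereal_gt0_lbound a1.
have [m2 m2_gt0 alpha_ge] := ereal_gt0_lbound a2_alpha.
have K_gt0 : (0 < 2 * c * (1 + expR (- (c * r1))))%R.
  by rewrite !mulr_gt0// addr_gt0// expR_gt0.
have [t1 [t1_ge0 t1_le t1_ub]] := ereal_sup_ge0_affine K_gt0 a_ge.
rewrite -[X in X + 1 <= _]mul1e in c_ge.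
have [t2 [t2_ge0 t2_le t2_ub]] := ereal_sup_ge0_affine ltr01 c_ge.
rewrite mul1r in t2_le.
set e1 := expR (- (c * r1)) in K_gt0 t1_le.
have e1_gt0 : (0 < e1)%R by exact: expR_gt0.
(* [A] bounds rho on (0, r1], and rho <= A r / r1 beyond r1. *)
pose A := (a + 1 + c * e1 * r1)%R.
have ce1r1_gt0 : (0 < c * e1 * r1)%R by rewrite !mulr_gt0.
have A_gt0 : (0 < A)%R by rewrite addr_gt0// addr_gt0.
(* The gains of the three ranges; the entry A / 2 keeps delta / A below 1. *)
pose delta := (Num.min (Num.min (a * m1 / 2) (c ^+ 2 / 2 * e1 * m2))
  (Num.min (c * e1 * c0 * r1) (A / 2)))%R.
have delta_gt0 : (0 < delta)%R.
  by rewrite !lt_min !mulr_gt0 ?invr_gt0 ?exprn_gt0.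
have [d1 d2 d3 d4] : [/\ (delta <= a * m1 / 2)%R,
    (delta <= c ^+ 2 / 2 * e1 * m2)%R, (delta <= c * e1 * c0 * r1)%R &
    (delta <= A / 2)%R].
  by split; rewrite /delta !ge_min lexx ?orbT.
exists (delta / A)%R.
  rewrite divr_gt0//= ltr_pdivrMr// mul1r (le_lt_trans d4)//.
  by rewrite ltr_pdivrMr// ltr_pMr// ltr1n.
move=> x y; set r := mdist x y.
pose Q : probability Omega R := pker_fiber P (x, y).
pose D w := mdist (X w) (Y w).
have D_meas : measurable_fun setT D by exact: measurable_mdist.
have D_ge0 w : (0 <= D w)%R by exact: mdist_ge0.
have [r_eq0|r_neq0] := eqVneq r 0%R.
  have xy : x = y by exact: mdist_positivity.
  have QD0 : Q [set w | D w = 0%R] = 1.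
    rewrite -(P_diag x) /Q /pker_fiber -xy; congr (P (x, x) _).
    apply/seteqP; split => w /=; rewrite /D; first exact: mdist_positivity.
    by move=> ->; exact: mdistxx.
  have -> : \int[P (x, y)]_w (rho a c r1 (X w) (Y w))%:E = 0.
    exact: (@integral_rho_dist0 _ _ _ Q _ D_meas a c r1 QD0).
  rewrite lee_fin /rho -/r r_eq0 ltxx /f0.
  by rewrite !mulr0 oppr0 expR0 subrr !addr0 mulr0.
have r_gt0 : (0 < r)%R by rewrite lt0r r_neq0 mdist_ge0.
have beta_le : coupling_beta P X Y x y <= beta_sup P X Y r.
  by apply: ereal_sup_ubound; exists (x, y).
have pi_le : pi_inf P X Y r <= coupling_pi P X Y x y.
  by apply: ereal_inf_lbound; exists (x, y).
have alpha_le : alpha_inf P X Y r <= coupling_alpha P X Y x y.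
  by apply: ereal_inf_lbound; exists (x, y).
have att (I : set R) : I r -> attained S I r.
  by move=> Ir; split => //; exists x, y.
have beta_fin : coupling_beta P X Y x y < +oo.
  apply: (le_lt_trans beta_le); have [rr1|rr1] := leP r r1.
    apply: le_lt_trans a2_beta; apply: ereal_sup_ubound; exists r => //.
    by apply: att; rewrite /= in_itv /= r_gt0.
  by apply: (le_lt_trans (a3 r rr1)); exact: ltry.
have [pi0 [b [al [pE bE alE rho_le]]]] :=
  @expectation_rho_le _ _ _ Q _ D_meas D_ge0 _ _ r1 _
    (ltW a_gt0) c_gt0 (ltW r_gt0) beta_fin.
have p_ge0 : (0 <= pi0)%R by rewrite -lee_fin -pE; exact: measure_ge0.
have al_ge0 : (0 <= al)%R.
  rewrite -lee_fin -alE mule_ge0 ?lee_fin ?invr_ge0//; apply: integral_ge0 => w _.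
  by rewrite lee_fin; have /andP[] := left_square_bounded D_ge0 r w.
rewrite -[coupling_pi _ _ _ _ _]/(Q [set w | D w = 0%R]) pE in pi_le.
rewrite -[coupling_alpha _ _ _ _ _]/
  ((2^-1)%:E * \int[Q]_w (left_square D r w)%:E) alE in alpha_le.
rewrite -[coupling_beta _ _ _ _ _]/(\int[Q]_w (D w - r)%:E) bE in beta_le.
apply: (le_trans rho_le); rewrite lee_fin.
have rhoE : rho a c r1 x y = (a + f0 c r1 r)%R.
  by rewrite /rho -/r r_gt0 mulr1.
have f0_le := f0_le_affine c r1 r; rewrite -/e1 in f0_le.
rewrite rhoE mulrBl mul1r.
have cs_le : (r <= r1 -> delta / A * (a + f0 c r1 r) <= delta)%R.
  move=> rr1; rewrite -mulrA ler_piMr ?(ltW delta_gt0)// mulrC ler_pdivrMr//.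
  rewrite mul1r /A -addrA lerD2l (le_trans f0_le)// lerD2l.
  by rewrite ler_pM2l// mulr_gt0.
have [rr1|rr1] := leP r r1; last first.
  have br : (b <= - c0 * r)%R by rewrite -lee_fin (le_trans beta_le)// a3.
  have := drift_large r1 a_gt0 c_gt0 c0_gt0 (ltW r_gt0) p_ge0 al_ge0 br.
  move=> /le_trans; apply.
  rewrite lerB// -/e1.
  have : (a + f0 c r1 r <= A * (r / r1))%R.
    rewrite mulrA ler_pdivlMr// /A.
    have : (a * r1 <= a * r)%R by rewrite ler_pM2l// ltW.
    nra.
  move=> /(ler_wpM2l (ltW (divr_gt0 delta_gt0 A_gt0))) /le_trans; apply.
  rewrite mulrA mulfVK ?gt_eqF// mulrA ler_pdivrMr// mulrAC ler_pM2r//.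
have [rr0|rr0] := leP r r0.
  have Ir : attained S `]0%R, r0] r by apply: att; rewrite /= in_itv /= r_gt0.
  have pi_lb : m1%:E <= pi_inf P X Y r.
    by apply: (le_trans pi_ge); apply: ereal_inf_lbound; exists r.
  have bt : (b <= t1 * pi0)%R.
    apply: (@le_of_ratio_le _ (maxe (beta_sup P X Y r) 0)
      (pi_inf P X Y r)) => //.
    - by rewrite le_max lexx orbT.
    - by rewrite le_max beta_le.
    - by rewrite (lt_le_trans _ pi_lb)// lte_fin.
    - by apply: t1_ub; exists r.
  have mp : (m1 <= pi0)%R by rewrite -lee_fin (le_trans pi_lb).
  have := drift_small a_gt0 c_gt0 (ltW r_gt0) t1_ge0 t1_le m1_gt0 mp bt al_ge0.
  have := cs_le rr1; lra.
have Ir : attained S `]r0, r1] r by apply: att; rewrite /= in_itv /= rr0.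
have alpha_lb : m2%:E <= alpha_inf P X Y r.
  by apply: (le_trans alpha_ge); apply: ereal_inf_lbound; exists r.
have bt : (4 * b <= t2 * al)%R.
  apply: (@le_of_ratio_le _ (4%:E * maxe (beta_sup P X Y r) 0)
    (alpha_inf P X Y r)) => //.
  - by rewrite mule_ge0 ?lee_fin// le_max lexx orbT.
  - by rewrite EFinM lee_pmul2l// le_max beta_le.
  - by rewrite (lt_le_trans _ alpha_lb)// lte_fin.
  - by apply: t2_ub; exists r.
have mal : (m2 <= al)%R by rewrite -lee_fin (le_trans alpha_lb).
have := drift_medium a_gt0 c_gt0 rr1 t2_ge0 t2_le p_ge0 m2_gt0 mal bt.
have := cs_le rr1; rewrite -/e1; lra.
Qed.
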